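(* Let $n\ge1$ and identify $\bigoplus_{d=0}^nH^*(Gr(d,n))$ with $\bigwedge^*(V(n))$, where $V(n)$ is the $\mathbb{Q}$-vector space with basis $\phi_0,\ldots,\phi_{n-1}$, by letting $\Phi_{\mathbf{k}}=\phi_{k_1}\wedge\cdots\wedge\phi_{k_d}$ ($0\le k_1<\cdots<k_d\le n-1$) correspond to the Schur class $s_{\lambda(\mathbf{k})}(x_1,\ldots,x_d)\in H^*(Gr(d,n))$. Then the decreasing operators are the right partial derivative operators on $\bigwedge^*(V(n))$: for all $0\le r\le n-1$ and all $\mathbf{k}$, $$\phi_r^-\cdot\Phi_{\mathbf{k}}=\partial_{n-r-1}^R(\Phi_{\mathbf{k}}).$$
   Context: All cohomology has $\mathbb{Q}$-coefficients. $Gr(d,n)$ is the Grassmannian of $d$-dimensional quotients of $\mathbb{C}^n$; classes in $H^*(Gr(d,n))$ are written as symmetric polynomials in the Chern roots $x_1,\ldots,x_d$ of the universal quotient bundle. Via pullback to the full flag variety, $H^*(Gr(d,n))$ is a subalgebra of $R(n)=\mathbb{Q}[x_1,\ldots,x_n]/(e_1,\ldots,e_n)$, where $e_i$ is the $i$-th elementary symmetric polynomial in $x_1,\ldots,x_n$. For $\mathbf{k}=(k_1,\ldots,k_d)$ with $0\le k_1<\cdots<k_d\le n-1$, $\lambda(\mathbf{k})=(\lambda_d,\ldots,\lambda_1)$ is the partition with $\lambda_i=k_i-i+1$. Decreasing operators: let $F_{d-1,d,n}$ be the variety of flags of quotients $\mathbb{C}^n\twoheadrightarrow E\twoheadrightarrow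 E_2$ with $\dim E=d$, $\dim E_2=d-1$, with projections $p:F_{d-1,d,n}\to Gr(d,n)$ and $p_2:F_{d-1,d,n}\to Gr(d-1,n)$, and let $\xi$ be the first Chern class of the line bundle $\ker(E\to E_2)$ on $F_{d-1,d,n}$. For $1\le d\le n$ and $\psi\in H^*(Gr(d,n))$ put $\phi_{r,d}^-\cdot\psi=(p_2)_*(\xi^r\cup p^*\psi)\in H^*(Gr(d-1,n))$; for $d=0$ put $\phi_{r,0}^-=0$. The decreasing operator is $\phi_r^-=\sum_{d=0}^n\phi_{r,d}^-$. Explicitly, for $f\in H^*(Gr(d,n))$ a symmetric polynomial in $d$ variables, $\phi_r^-\cdot f$ is the class in $R(n)$ of $\sum_{j=d}^{n}\frac{f(x_1,\ldots,x_{d-1},x_j)\,x_j^r}{\prod_{l\in\{d,\ldots,n\},\,l\neq j}(x_j-x_l)}$. Right partial derivative: for $k_1<\cdots<k_d$, if $i=k_s$ then $\partial_i^R(\phi_{k_1}\wedge\cdots\wedge\phi_{k_d})=(-1)^{d-s}\phi_{k_1}\wedge\cdots\wedge\widehat{\phi_{k_s}}\wedge\cdots\wedge\phi_{k_d}$; if $i\notin\{k_1,\ldots,k_d\}$ then $\partial_i^R(\phi_{k_1}\wedge\cdots\wedge\phi_{k_d})=0$. *)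

(* Defs.v *)
From HB Require Import structures.
From mathcomp Require Import all_boot all_order all_algebra.
From mathcomp Require Import mpoly.
From mathcomp Require Import boolp classical_sets functions.

Set Implicit Arguments.
Unset Strict Implicit.
Unset Printing Implicit Defensive.

Import GRing.Theory.
Local Open Scope ring_scope.
Local Open Scope quotient_scope.

(* Indices are 0-based throughout: x_1, ..., x_n are 'X_0, ..., 'X_(n-1), and
   (k_1, ..., k_d) is the sequence of the k`_0, ..., k`_(d-1). *)

(** * The ring R(n) = Q[x_1, ..., x_n] / (e_1, ..., e_n) *)

Definition esym_ideal (n : nat) (p : {mpoly rat[n]}) : bool :=
  `[< exists a : 'I_n -> {mpoly rat[n]},
        p = \sum_(i < n) a i * mesym n rat i.+1 >].

Lemma esym_ideal_closed n : idealr_closed (@esym_ideal n).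
Proof.
split.
- apply/asboolP; exists (fun=> 0).
  by rewrite big1 // => i _; rewrite mul0r.
- apply/negP => /asboolP [a] /(congr1 (mcoeff 0%MM)).
  rewrite rmorph1 raddf_sum big1 => [/eqP|i _]; first by rewrite oner_eq0.
  rewrite [LHS](rmorphM (mcoeff 0%MM)) [X in _ * X](_ : _ = 0) ?mulr0 //.
  by rewrite [LHS]mcoeff_mesym /mechar mdeg0.
- move=> c u v /asboolP [a ->] /asboolP [b ->].
  apply/asboolP; exists (fun i => c * a i + b i).
  rewrite mulr_sumr -big_split; apply: eq_bigr => i _ /=.
  by rewrite mulrDl mulrA.
Qed.

HB.instance Definition _ n :=
  isIdealr.Build {mpoly rat[n]} (@esym_ideal n) (@esym_ideal_closed n).

Definition Rn (n : nat) := {ideal_quot (@esym_ideal n : idealr {mpoly rat[n]})}.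

Definition cls (n : nat) (p : {mpoly rat[n]}) : Rn n :=
  \pi_(Rn n) p.

Lemma clsB n : {morph @cls n : p q / p - q}.
Proof. exact: raddfB. Qed.

Lemma cls_monoid n : monoid_morphism (@cls n).
Proof. by split; [exact: rmorph1 | exact: rmorphM]. Qed.

HB.instance Definition _ n :=
  GRing.isZmodMorphism.Build {mpoly rat[n]} (Rn n) (@cls n) (@clsB n).
HB.instance Definition _ n :=
  GRing.isMonoidMorphism.Build {mpoly rat[n]} (Rn n) (@cls n) (@cls_monoid n).

(** * H^*(Gr(d,n)) inside R(n) *)

Definition xvar (n i : nat) : {mpoly rat[n]} := oapp (fun j => 'X_j) 0 (insub i).

(* f(x_1, ..., x_d) as a polynomial in x_1, ..., x_n (for d <= n) *)
Definition widen_poly (n d : nat) (f : {mpoly rat[d]}) : {mpoly rat[n]} :=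
  f \mPo [tuple xvar n i | i < d].

Definition HGr (n d : nat) : set (Rn n) :=
  [set x | exists2 f : {mpoly rat[d]}, f \is symmetric & x = cls (widen_poly n f)].

(* The direct sum of the H^*(Gr(d,n)), 0 <= d <= n, inside n+1 copies of R(n) *)
Definition HGr_sum (n : nat) : set {ffun 'I_n.+1 -> Rn n} :=
  [set g | forall d : 'I_n.+1, HGr d (g d)].

(* The polynomial equal to the rational function q, when there is one
   (and 0 otherwise) *)
Definition poly_of_frac (n : nat) (q : {fraction {mpoly rat[n]}}) :
    {mpoly rat[n]} :=
  xget 0 [set p | tofrac p = q].

(** * Schur polynomials, as ratios of alternants *)

Definition alternant (d : nat) (a : 'I_d -> nat) : {mpoly rat[d]} :=
  \det (\matrix_(i < d, j < d) 'X_i ^+ a j).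

(* lam is listed in decreasing order and has at most d parts;
   rev_ord j is d - 1 - j *)
Definition schur (d : nat) (lam : seq nat) : {mpoly rat[d]} :=
  poly_of_frac
    (tofrac (alternant (fun j : 'I_d => nth 0 lam j + rev_ord j)%N)
       / tofrac (alternant (fun j : 'I_d => rev_ord j : nat))).

(* lambda(k) = (lambda_d, ..., lambda_1); with 0-based i, lambda_i = k_i - i *)
Definition part_of (k : seq nat) : seq nat :=
  rev [seq nth 0 k i - i | i <- iota 0 (size k)]%N.

(** * The decreasing operators *)

(* f(x_1, ..., x_(d-1), x_j) *)
Definition subst_last (n d : nat) (j : 'I_n) (f : {mpoly rat[d]}) :
    {mpoly rat[n]} :=
  f \mPo [tuple if (i < d.-1)%N then xvar n i else 'X_j | i < d].

Definition decr_frac (n r d : nat) (f : {mpoly rat[d]}) :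
    {fraction {mpoly rat[n]}} :=
  \sum_(j < n | (d.-1 <= j)%N)
    tofrac (subst_last j f * 'X_j ^+ r)
      / tofrac (\prod_(l < n | (d.-1 <= l)%N && (l != j)) ('X_j - 'X_l)).

(* phi^-_{r,d} for 1 <= d <= n: the explicit formula is applied to a symmetric
   polynomial f representing psi; its class does not depend on that choice. *)
Definition decr_comp (n r d : nat) (psi : Rn n) : Rn n :=
  let f := xget 0 [set f : {mpoly rat[d]} |
                     f \is symmetric /\ cls (widen_poly n f) = psi] in
  cls (poly_of_frac (decr_frac n r f)).

(* phi^-_r; the component of degree d is mapped to degree d - 1, and the
   component of degree 0 to 0. *)
Definition decr (n r : nat) (g : {ffun 'I_n.+1 -> Rn n}) :
    {ffun 'I_n.+1 -> Rn n} :=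
  [ffun e : 'I_n.+1 => \sum_(d < n.+1 | d == e.+1 :> nat) decr_comp r d (g d)].

(** * The exterior algebra of V(n) *)

(* v K is the coordinate of v on phi_(k_1) /\ ... /\ phi_(k_d), where
   K = {k_1 < ... < k_d}. *)
Definition extalg (n : nat) := {ffun {set 'I_n} -> rat^o}.

Definition ext_basis (n : nat) (K : {set 'I_n}) : extalg n :=
  [ffun L => (L == K)%:R].

(* The number of transpositions needed to sort the concatenation of the
   increasing enumerations of A and B *)
Definition inversions (n : nat) (A B : {set 'I_n}) : nat :=
  #|[set ab in finset.setX A B | (ab.2 < ab.1)%N]|.

Definition wedge (n : nat) (u v : extalg n) : extalg n :=
  \sum_(A : {set 'I_n}) \sum_(B : {set 'I_n} | [disjoint A & B])
    ((-1) ^+ inversions A B * u A * v B) *: ext_basis (A :|: B).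

Definition phi (n : nat) (i : 'I_n) : extalg n := ext_basis [set i].

Definition Phi (n : nat) (k : seq 'I_n) : extalg n :=
  foldr (fun i => wedge (phi i)) (ext_basis finset.set0) k.

Definition partialR_basis (n : nat) (i : 'I_n) (K : {set 'I_n}) : extalg n :=
  (* if i = k_s, then s = (index i (enum K)).+1 *)
  if i \in K then (-1) ^+ (#|K| - (index i (enum K)).+1) *: ext_basis (K :\ i)
  else 0.

Definition partialR (n : nat) (i : 'I_n) (v : extalg n) : extalg n :=
  \sum_(K : {set 'I_n}) v K *: partialR_basis i K.

(** * The identification *)

Definition schur_of_set (n : nat) (K : {set 'I_n}) (d : nat) : {mpoly rat[n]} :=
  widen_poly n (schur d (part_of [seq val i | i <- enum K])).

Definition Theta (n : nat) (v : extalg n) : {ffun 'I_n.+1 -> Rn n} :=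
  [ffun d : 'I_n.+1 =>
     cls (\sum_(K : {set 'I_n} | #|K| == d) v K *: schur_of_set K d)].

Lemma enum_sorted n (k : seq 'I_n) :
  sorted (fun i j : 'I_n => i < j)%N k -> enum [set i in k] = k.
Proof.
move=> sk.
have tr : transitive (fun i j : 'I_n => i < j)%N by move=> ? ? ?; exact: ltn_trans.
have ir : irreflexive (fun i j : 'I_n => i < j)%N by move=> i; exact: ltnn.
apply: (irr_sorted_eq tr ir) => //; last by move=> i; rewrite mem_enum inE.
rewrite /enum_mem; apply: sorted_filter => //; rewrite -enumT.
have: sorted ltn [seq val i | i <- enum 'I_n]; last by rewrite sorted_map.
by rewrite val_enum_ord iota_ltn_sorted.
Qed.

Lemma wedge_basis n (A B : {set 'I_n}) : [disjoint A & B] ->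
  wedge (ext_basis A) (ext_basis B) =
  (-1) ^+ inversions A B *: ext_basis (A :|: B).
Proof.
move=> dAB; rewrite /wedge (bigD1 A) //= (bigD1 B) //= !ffunE !eqxx !mulr1.
rewrite big1 ?addr0 => [|C /andP[_ /negPf neC]]; last first.
  by rewrite ffunE neC mulr0 scale0r.
rewrite big1 ?addr0 // => C /negPf neC; apply: big1 => D _.
by rewrite ffunE neC mulr0 mul0r scale0r.
Qed.

(* The iterated wedge product is the basis vector it should be. *)
Lemma PhiE n (k : seq 'I_n) :
  sorted (fun i j : 'I_n => i < j)%N k -> Phi k = ext_basis [set i in k].
Proof.
elim: k => [_|i k IHk] /=; first by rewrite finset.set_nil.
have tr : transitive (fun i j : 'I_n => i < j)%N by move=> ? ? ?; exact: ltn_trans.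
rewrite (path_sortedE tr) => /andP[/allP lt_ik /IHk ->].
rewrite wedge_basis ?finset.set_cons; last first.
  by rewrite disjoints1 inE; apply/negP => /lt_ik; rewrite ltnn.
rewrite /inversions (_ : finset _ = finset.set0) ?cards0 ?expr0 ?scale1r //.
apply/setP => -[a b]; rewrite !inE /= -andbA; apply/negP.
by move=> /and3P[/eqP -> /lt_ik]; rewrite ltnNge => /negP nlt /ltnW.
Qed.

(* Phi_k corresponds to the Schur class s_(lambda(k))(x_1, ..., x_d). *)
Lemma Theta_Phi n (d : 'I_n.+1) (k : d.-tuple 'I_n) :
  sorted (fun i j : 'I_n => i < j)%N k ->
  Theta (Phi k) =
  [ffun e => if e == d
             then cls (widen_poly n (schur d (part_of [seq val i | i <- k])))
             else 0].
Proof.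
move=> sk; have tr : transitive (fun i j : 'I_n => i < j)%N.
  by move=> ? ? ?; exact: ltn_trans.
have uk : uniq k by apply: sorted_uniq sk => // i; exact: ltnn.
have cK : #|[set i in k]| = d by rewrite cardsE (card_uniqP uk) size_tuple.
apply/ffunP => e; rewrite !ffunE PhiE //; case: eqP => [->|ne_ed].
  rewrite (bigD1 [set i in k]) ?cK ?eqxx //= ffunE eqxx scale1r.
  rewrite big1 ?addr0 /schur_of_set ?enum_sorted // => K /andP[_ /negPf neK].
  by rewrite ffunE neK scale0r.
rewrite big1 /cls ?raddf0 // => K /eqP cKe; rewrite ffunE.
case: eqP => [eK|]; last by rewrite scale0r.
by case: ne_ed; apply/val_inj; rewrite /= -cKe eK cK.
Qed.

Lemma partialR_Phi n (i : 'I_n) (k : seq 'I_n) :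
  sorted (fun i j : 'I_n => i < j)%N k ->
  partialR i (Phi k) =
  if i \in k then (-1) ^+ (size k - (index i k).+1) *: Phi (rem i k) else 0.
Proof.
move=> sk; have tr : transitive (fun i j : 'I_n => i < j)%N.
  by move=> ? ? ?; exact: ltn_trans.
have uk : uniq k by apply: sorted_uniq sk => // j; exact: ltnn.
have srk : sorted (fun i j : 'I_n => i < j)%N (rem i k).
  exact: subseq_sorted (rem_subseq i k) sk.
rewrite /partialR (bigD1 [set j in k]) //= PhiE // ffunE eqxx scale1r.
rewrite big1 ?addr0 => [|K /negPf neK]; last by rewrite ffunE neK scale0r.
rewrite /partialR_basis inE; case: ifP => // _.
rewrite enum_sorted // cardsE (card_uniqP uk) PhiE //.
by congr (_ *: ext_basis _); apply/setP => j; rewrite !inE mem_rem_uniq // inE.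
Qed.

(* Main.v *)
Require Import Defs.
From HB Require Import structures.
From mathcomp Require Import all_boot all_order all_algebra.
From mathcomp Require Import fingroup perm mpoly.
From mathcomp Require Import boolp classical_sets functions.
From mathcomp Require Import ring zify.

(** Write S_a, for a = (a_1, ..., a_d) an arbitrary sequence of exponents, for
    the polynomial det(x_i^(a_j)) / Vandermonde(x_1, ..., x_d), here [gschur];
    the Schur polynomial of lambda(k) is S_k.  Everything rests on Newton
    interpolation at the nodes x_1, x_2, ...: if h(k, m) is the coefficient of
    (t - x_1)...(t - x_m) in the expansion of t^k, then S_a = det(h(a_j, m)),
    by factoring the matrix of the alternant ([det_alternant]).  In R(n) one
    has (t - x_1)...(t - x_n) = t^n, and therefore h(k, m) = 0 as soon as
    m < n <= k ([newton_coef_vanish]); hence the class of S_a vanishes when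
    some a_j >= n.

    Antisymmetrizing the product of a symmetric polynomial with the Vandermonde
    product shows that the S_a span the symmetric polynomials
    ([symmetric_gschur_span]), so that the S_k with k_1 < ... < k_d < n span
    H^*(Gr(d,n)).  Their classes are linearly independent
    ([schur_of_set_free]).  Indeed, let tau(p) be the coefficient of
    x_1^0 x_2^1 ... x_n^(n-1) in the antisymmetrization of p ([alt_coef]).
    It vanishes on the ideal (e_1, ..., e_n): for a monomial x^m with two equal
    exponents x^m e_k is invariant under a transposition, and otherwise the
    degrees do not match.  On the other hand
    tau(Vandermonde(x_1, ..., x_d) S_k x_(d+1)^(l_1) ... x_n^(l_(n-d))), where
    l is the complement of a second set k', is +- d! if k = k' and 0 otherwise.
    So Theta is bijective.

    For the decreasing operator put S_a(x_1, ..., x_(d-1), x_j) over the common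
    denominator P'(x_j), where P(t) = (t - x_1)...(t - x_n): the missing factors
    are exactly those by which the Vandermonde product of
    x_1, ..., x_(d-1), x_j exceeds that of x_1, ..., x_(d-1).  What remains in
    the numerator is a determinant with last row (x_j^(a_s))_s, divided by
    Vandermonde(x_1, ..., x_(d-1)).  It is zero for j < d, so that the sum may
    be taken over all j.  Expanding along the last row gives
      phi_r^- S_a = sum_s (-1)^(d-s) S_(a without a_s) sum_j x_j^(a_s+r)/P'(x_j),
    and by Lagrange interpolation the inner sum is h(a_s + r, n - 1), whose class
    in R(n) is 1 if a_s = n - r - 1 and 0 otherwise ([cls_decr_gschur]).
    This is the formula for the right partial derivative.  It also holds when
    some a_j >= n, both sides being 0 in R(n); together with linear independence
    this makes the result independent of the symmetric polynomial chosen to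
    represent a class ([sym_decr], [decr_Theta]). *)

Set Implicit Arguments.
Unset Strict Implicit.
Unset Printing Implicit Defensive.

Import GRing.Theory.
Local Open Scope ring_scope.

(** * Newton interpolation and alternants over a commutative ring *)

Section Newton.
Variable T : comNzRingType.
Implicit Types (y z : nat -> T) (t : T) (k m d : nat) (q : {poly T}).

(** (t - y_0) ... (t - y_(m-1)) *)
Definition newton_prod y m t : T := \prod_(l < m) (t - y l).

(** The coefficient of [newton_prod y m t] in the Newton expansion of t^k, that
    is h_(k-m)(y_0, ..., y_m).  The recursion on k comes from
    t * newton_prod y m t = newton_prod y (m+1) t + y_m * newton_prod y m t. *)
Fixpoint newton_coef y k m : T :=
  if k is k'.+1 then
    y m * newton_coef y k' m + (if m is m'.+1 then newton_coef y k' m' else 0)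
  else (m == 0)%:R.

Lemma newton_prodS y m t : newton_prod y m.+1 t = newton_prod y m t * (t - y m).
Proof. by rewrite /newton_prod big_ord_recr. Qed.

(** At a zero of (t - y_0) ... (t - y_(d-1)) the Newton expansion of t^k stops
    at the first d terms, whatever k is. *)
Lemma newton_expansion y d t k : newton_prod y d t = 0 ->
  t ^+ k = \sum_(m < d) newton_coef y k m * newton_prod y m t.
Proof.
case: d => [|d] Pd0.
  by move: Pd0; rewrite /newton_prod big_ord0 => /eqP; rewrite oner_eq0.
elim: k => [|k IHk] /=.
  rewrite big_ord_recl /= mul1r /newton_prod big_ord0 big1 ?addr0 // => i _.
  by rewrite mul0r.
rewrite exprS {}IHk; under [RHS]eq_bigr do rewrite mulrDl.
rewrite big_split /= [X in _ + X]big_ord_recl /= mul0r add0r.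
rewrite mulr_sumr.
have -> : \sum_(i < d.+1) t * (newton_coef y k i * newton_prod y i t) =
  \sum_(i < d.+1) y i * newton_coef y k i * newton_prod y i t +
  \sum_(i < d.+1) newton_coef y k i * newton_prod y i.+1 t.
  rewrite -big_split /=; apply: eq_bigr => i _; rewrite newton_prodS; ring.
by rewrite [X in _ + X = _]big_ord_recr /= Pd0 mulr0 addr0.
Qed.

Lemma eq_newton_coef y z k m : (forall l, (l <= m)%N -> y l = z l) ->
  newton_coef y k m = newton_coef z k m.
Proof.
elim: k m => // k IHk [|m] eq_yz /=; first by rewrite eq_yz // IHk.
by rewrite eq_yz // !IHk // => l le_lm; apply: eq_yz; apply: ltnW.
Qed.

Lemma newton_coef_gt y k m : (k < m)%N -> newton_coef y k m = 0.
Proof.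
elim: k m => [|k IHk] [|m] //= lt_km.
by rewrite !IHk // ?mulr0 ?addr0 // ltnW.
Qed.

Lemma newton_coef_diag y k : newton_coef y k k = 1.
Proof. by elim: k => //= k ->; rewrite newton_coef_gt // mulr0 add0r. Qed.

(** The linear functional t^k |-> newton_coef y k m on polynomials, i.e. the
    divided difference at y_0, ..., y_m *)
Definition newton_lin y m (q : {poly T}) : T :=
  \sum_(i < size q) q`_i * newton_coef y i m.

Lemma newton_linE y m q D : (size q <= D)%N ->
  newton_lin y m q = \sum_(i < D) q`_i * newton_coef y i m.
Proof.
move=> sq; rewrite /newton_lin.
rewrite (big_ord_widen _ (fun i => q`_i * newton_coef y i m) sq) big_mkcond /=.
apply: eq_bigr => i _; case: ltnP => // le; by rewrite nth_default ?mul0r.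
Qed.

Lemma newton_lin_mulX y m q :
  newton_lin y m (('X - (y m)%:P) * q) =
  if m is m'.+1 then newton_lin y m' q else 0.
Proof.
have s1 : (size (('X - (y m)%:P) * q)%R <= (size q).+1)%N.
  by apply: leq_trans (size_polyMleq _ _) _; rewrite size_XsubC.
rewrite (newton_linE _ _ s1).
under eq_bigr => i _ do rewrite mulrBl coefB coefXM coefCM mulrBl.
rewrite sumrB big_ord_recl /= mul0r add0r.
rewrite [X in _ - X]big_ord_recr /= nth_default // mulr0 mul0r addr0 -sumrB.
case: m s1 => [|m] _ /=.
  by rewrite big1 // => i _; rewrite add0n; ring.
by apply: eq_bigr => i _; rewrite /= add0n; ring.
Qed.

Lemma newton_lin_prod y m n q : (m < n)%N ->
  newton_lin y m ((\prod_(l < n) ('X - (y l)%:P)) * q) = 0.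
Proof.
elim: n m q => // n IHn m q lt_mn; rewrite big_ord_recr /= -mulrA.
case: (ltnP m n) => [/IHn-> //|le_nm].
have {le_nm lt_mn} -> : m = n by apply/eqP; rewrite eqn_leq le_nm andbT.
rewrite mulrCA newton_lin_mulX; case: n IHn => // n IHn; exact: IHn.
Qed.

Lemma newton_coef_vanish y n k m :
    \prod_(l < n) ('X - (y l)%:P) = 'X^n ->
  (m < n)%N -> (n <= k)%N -> newton_coef y k m = 0.
Proof.
move=> defXn lt_mn le_nk.
have := newton_lin_prod y 'X^(k - n) lt_mn; rewrite defXn -exprD subnKC //.
rewrite /newton_lin size_polyXn big_ord_recr /= coefXn eqxx mul1r.
rewrite big1 ?add0r // => i _; by rewrite coefXn ltn_eqF ?mul0r.
Qed.

(** The Vandermonde product of the y_i - y_l for l < i < d *)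
Definition vand y d : T := \prod_(i < d) newton_prod y i (y i).

Lemma vandS y d : vand y d.+1 = vand y d * newton_prod y d (y d).
Proof. by rewrite /vand big_ord_recr. Qed.

Lemma newton_prod_eq0 y m i : (i < m)%N -> newton_prod y m (y i) = 0.
Proof.
by move=> lt_im; rewrite /newton_prod (bigD1 (Ordinal lt_im)) //= subrr mul0r.
Qed.

(** The alternant of exponents a in y_0, ..., y_(d-1) divided by the Vandermonde
    product, written as a determinant so that it makes sense even if the
    Vandermonde product is a zero divisor, as in R(n) for 1 < d <= n *)
Definition newton_det y d (a : 'I_d -> nat) : T :=
  \det (\matrix_(m < d, j < d) newton_coef y (a j) m).

Lemma det_alternant y d (a : 'I_d -> nat) :
  \det (\matrix_(i < d, j < d) y i ^+ a j) = vand y d * newton_det y a.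
Proof.
have -> : \matrix_(i < d, j < d) y i ^+ a j =
  (\matrix_(i < d, m < d) newton_prod y m (y i)) *m
  (\matrix_(m < d, j < d) newton_coef y (a j) m).
  apply/matrixP => i j; rewrite !mxE (@newton_expansion y d) ?newton_prod_eq0 //.
  by apply: eq_bigr => m _; rewrite !mxE mulrC.
rewrite det_mulmx det_trig; last first.
  by apply/is_trig_mxP => i j lt_ij; rewrite !mxE newton_prod_eq0.
by congr (_ * _); apply: eq_bigr => i _; rewrite mxE.
Qed.

Lemma eq_newton_det y z d (a b : 'I_d -> nat) :
    (forall l, (l < d)%N -> y l = z l) -> (forall i, a i = b i) ->
  newton_det y a = newton_det z b.
Proof.
move=> eq_yz eq_ab; congr (\det _); apply/matrixP => m j; rewrite !mxE eq_ab.
by apply: eq_newton_coef => l le_lm; apply/eq_yz/(leq_ltn_trans le_lm).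
Qed.

Lemma newton_det_id y d : newton_det y (fun i : 'I_d => i : nat) = 1.
Proof.
rewrite /newton_det -det_tr det_trig; last first.
  by apply/is_trig_mxP => i j lt_ij; rewrite !mxE newton_coef_gt.
by rewrite big1 // => i _; rewrite !mxE newton_coef_diag.
Qed.

Lemma newton_det_perm y d (a : 'I_d -> nat) (s : 'S_d) :
  newton_det y (a \o s) = (-1) ^+ s * newton_det y a.
Proof.
rewrite /newton_det -odd_permV -det_perm mulrC -det_mulmx -col_permE.
by congr (\det _); apply/matrixP => m j; rewrite !mxE.
Qed.

Lemma newton_det_dup y d (a : 'I_d -> nat) i j :
  i != j -> a i = a j -> newton_det y a = 0.
Proof.
move=> ne_ij eq_a; rewrite /newton_det -det_tr.
by apply: (determinant_alternate ne_ij) => m; rewrite !mxE eq_a.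
Qed.

(** When y_0, ..., y_(n-1) satisfy (t - y_0) ... (t - y_(n-1)) = t^n, an exponent
    at least n produces a zero column. *)
Lemma newton_det_vanish y n d (a : 'I_d -> nat) j :
    \prod_(l < n) ('X - (y l)%:P) = 'X^n ->
  (d <= n)%N -> (n <= a j)%N -> newton_det y a = 0.
Proof.
move=> defXn le_dn le_na; rewrite /newton_det (expand_det_col _ j) big1 // => m _.
by rewrite !mxE (newton_coef_vanish defXn) ?mul0r // (leq_trans _ le_dn).
Qed.

End Newton.

Section Morph.
Variables (T U : comNzRingType) (f : {rmorphism T -> U}).

Lemma rmorph_newton_coef (y : nat -> T) k m :
  f (newton_coef y k m) = newton_coef (f \o y) k m.
Proof.
elim: k m => [|k IHk] m /=; first by rewrite rmorph_nat.
by rewrite rmorphD rmorphM !IHk; case: m => [|m]; rewrite ?rmorph0 ?IHk.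
Qed.

Lemma rmorph_newton_det (y : nat -> T) d (a : 'I_d -> nat) :
  f (newton_det y a) = newton_det (f \o y) a.
Proof.
rewrite /newton_det -det_map_mx; congr (\det _); apply/matrixP => m j.
by rewrite !mxE rmorph_newton_coef.
Qed.
End Morph.

(** * The relations of R(n) *)

Lemma cls_eq0 n (p : {mpoly rat[n]}) : cls p = 0 <-> esym_ideal p.
Proof.
have -> : esym_ideal p = (\pi_(Rn n)%qT p == \pi_(Rn n)%qT 0).
  by rewrite -Quotient.idealrBE subr0.
rewrite -[\pi_(Rn n)%qT 0]/(cls 0) raddf0.
by split => /eqP.
Qed.

Lemma cls_mesym n k : (0 < k)%N -> cls (mesym n rat k) = 0.
Proof.
case: k => // k _; case: (ltnP k n) => [lt_kn|le_nk]; last first.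
  by rewrite mesym_geqnE ?raddf0.
apply/cls_eq0/asboolP; exists (fun i => (i == Ordinal lt_kn)%:R).
rewrite (bigD1 (Ordinal lt_kn)) //= eqxx mul1r big1 ?addr0 // => i /negPf ->.
by rewrite mul0r.
Qed.

Lemma xvar_ord n (i : 'I_n) : xvar n i = 'X_i.
Proof. by rewrite /xvar valK. Qed.

Lemma prod_cls_xvar n :
  \prod_(l < n) ('X - (cls (xvar n l))%:P) = 'X^n :> {poly Rn n}.
Proof.
(* Vieta's formula with integer coefficients, mapped to R(n) *)
pose f : {mpoly int[n]} -> Rn n := mmap intr (fun i => cls 'X_i).
have := congr1 (map_poly f) (Viete n); rewrite rmorph_prod /=.
under eq_bigr => i _.
  rewrite rmorphB /= map_polyX map_polyC /= /f mmapX mmap1U -xvar_ord; over.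
move=> ->; rewrite raddf_sum big_ord_recl /= big1 ?addr0 => [|i _].
  by rewrite expr0 scale1r map_polyZ mesym0E rmorph1 scale1r map_polyXn subn0.
rewrite scalerA map_polyZ rmorphM /=; set e := (X in _ * X *: _).
have -> : e = 0; last by rewrite mulr0 scale0r.
rewrite -[RHS](@cls_mesym n i.+1) // {}/e /mesym !rmorph_sum; apply: eq_bigr => h _.
by rewrite !rmorph_prod; apply: eq_bigr => j _; rewrite /f /= mmapX mmap1U.
Qed.

(** * Schur polynomials of arbitrary exponents *)

(** S_a, the alternant of exponents a divided by the Vandermonde product; a need
    be neither sorted nor injective. *)
Definition gschur d (a : 'I_d -> nat) : {mpoly rat[d]} := newton_det (xvar d) a.

Lemma alternantE d (a : 'I_d -> nat) :
  alternant a = vand (xvar d) d * gschur a.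
Proof.
rewrite -det_alternant; congr (\det _); apply/matrixP => i j.
by rewrite !mxE xvar_ord.
Qed.

Lemma xvar_inj n i j : (i < n)%N -> (j < n)%N -> xvar n i = xvar n j -> i = j.
Proof.
move=> lt_in lt_jn; rewrite -[i]/(val (Ordinal lt_in)) -[j]/(val (Ordinal lt_jn)).
rewrite !xvar_ord => /(congr1 (mcoeff U_(Ordinal lt_in)%MM)) /eqP.
rewrite !mcoeffX eqxx eq_mnm1 [Ordinal lt_jn == _]eq_sym.
by case: (eqVneq (Ordinal lt_in) (Ordinal lt_jn)) => [->|_] //; rewrite oner_eq0.
Qed.

Lemma vand_xvar_neq0 n d : (d <= n)%N -> vand (xvar n) d != 0.
Proof.
move=> le_dn; apply/prodf_neq0 => i _; apply/prodf_neq0 => l _.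
rewrite subr_eq0; apply/negP => /eqP eq_il.
have lt_in := leq_trans (ltn_ord i) le_dn.
have := xvar_inj lt_in (ltn_trans (ltn_ord l) lt_in) eq_il.
by move=> eq_il'; have := ltn_ord l; rewrite -eq_il' ltnn.
Qed.

Lemma msym_alternant d (a : 'I_d -> nat) (s : 'S_d) :
  msym s (alternant a) = (-1) ^+ s * alternant a.
Proof.
rewrite /alternant -det_perm -det_mulmx -row_permE -det_map_mx.
congr (\det _); apply/matrixP => i j; rewrite !mxE rmorphXn /=.
by rewrite /msym mmapX mmap1U.
Qed.

Lemma alternant_id d : alternant (fun i : 'I_d => i : nat) = vand (xvar d) d.
Proof. by rewrite alternantE /gschur newton_det_id mulr1. Qed.

Lemma msym_vand d (s : 'S_d) :
  msym s (vand (xvar d) d) = (-1) ^+ s * vand (xvar d) d.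
Proof. by rewrite -alternant_id msym_alternant. Qed.

Lemma gschur_sym d (a : 'I_d -> nat) : gschur a \is symmetric.
Proof.
apply/issymP => s; apply: (mulfI (vand_xvar_neq0 (leqnn d))).
apply: (@mulfI _ ((-1) ^+ s)); first by rewrite signr_eq0.
by rewrite -alternantE -msym_alternant alternantE msymM msym_vand mulrA.
Qed.

Lemma poly_of_fracE n (p : {mpoly rat[n]}) : poly_of_frac (tofrac p) = p.
Proof.
rewrite /poly_of_frac; case: xgetP => [q _ /= /eqP|/(_ p)]; last by case.
by rewrite tofrac_eq => /eqP.
Qed.

(** The i-th smallest element of K (0-based), and 0 when i >= #|K| *)
Definition exps n (K : {set 'I_n}) i : nat := nth 0%N [seq val j | j <- enum K] i.

Lemma schur_part_of n (K : {set 'I_n}) :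
  schur #|K| (part_of [seq val i | i <- enum K]) = gschur (fun i : 'I_#|K| => exps K i).
Proof.
set k := [seq val i | i <- enum K].
have sz_k : size k = #|K| by rewrite size_map -cardE.
have srt_k : sorted ltn k.
  rewrite sorted_map /enum_mem; apply: sorted_filter; last first.
    by rewrite -sorted_map -enumT val_enum_ord iota_ltn_sorted.
  by move=> ? ? ?; exact: ltn_trans.
have le_nth i : (i < #|K|)%N -> (i <= nth 0 k i)%N.
  elim: i => // i IHi lt_iK; apply: leq_ltn_trans (IHi (ltnW lt_iK)) _.
  by rewrite (sorted_ltn_nth ltn_trans 0%N srt_k) ?inE ?sz_k // ltnW.
(* Both alternants in the definition of [schur] list their exponents in decreasing
   order; sorting them costs the sign of the same permutation s. *)
set d := #|K| in sz_k le_nth *; pose s : 'S_d := perm (@rev_ord_inj d).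
have alt_rev (a : 'I_d -> nat) : alternant (a \o s) = (-1) ^+ s * alternant a.
  by rewrite !alternantE /gschur newton_det_perm mulrCA.
have eq_alt (a b : 'I_d -> nat) : a =1 b -> alternant a = alternant b.
  by move=> eq_ab; congr (\det _); apply/matrixP => i j; rewrite !mxE eq_ab.
rewrite /schur (eq_alt _ ((fun i : 'I_d => exps K i) \o s)); last first.
  move=> i; rewrite /= permE /part_of sz_k nth_rev ?size_map ?size_iota //.
  have lt_r : (d - i.+1 < d)%N by exact: (ltn_ord (rev_ord i)).
  by rewrite (nth_map 0%N) ?size_iota // nth_iota // add0n subnK ?le_nth.
rewrite (eq_alt (fun j => rev_ord j) ((fun i : 'I_d => i : nat) \o s)); last first.
  by move=> i; rewrite /= permE.
rewrite !alt_rev alternant_id alternantE mulrA tofracM mulrAC divff.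
  by rewrite mul1r poly_of_fracE.
by rewrite tofrac_eq0 mulf_neq0 ?signr_eq0 ?vand_xvar_neq0.
Qed.

Lemma comp_mpoly_newton_det n d (T : d.-tuple {mpoly rat[n]}) (a : 'I_d -> nat) :
  gschur a \mPo T = newton_det (nth 0 T) a.
Proof.
rewrite [LHS]rmorph_newton_det; apply: eq_newton_det => // l lt_ld /=.
by rewrite -[l]/(val (Ordinal lt_ld)) xvar_ord comp_mpolyXU.
Qed.

Lemma widen_gschur n d (a : 'I_d -> nat) :
  widen_poly n (gschur a) = newton_det (xvar n) a.
Proof.
rewrite [LHS]comp_mpoly_newton_det; apply: eq_newton_det => // l lt_ld.
by rewrite -[l]/(val (Ordinal lt_ld)) -tnth_nth tnth_mktuple.
Qed.

Lemma schur_of_setE n d (K : {set 'I_n}) : #|K| = d ->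
  schur_of_set K d = newton_det (xvar n) (fun i : 'I_d => exps K i).
Proof. by move=> <-; rewrite /schur_of_set schur_part_of widen_gschur. Qed.

(** If V is the Vandermonde product, then V * f is antisymmetric, so that d! V f is
    the antisymmetrization of V f, where each monomial becomes an alternant. *)
Lemma symmetric_gschur_span d (f : {mpoly rat[d]}) : f \is symmetric ->
  exists (r : seq 'X_{1..d}) (c : 'X_{1..d} -> rat),
    f = \sum_(m <- r) c m *: gschur (fun i => m i).
Proof.
move=> /issymP sym_f; set g := vand (xvar d) d * f.
exists (msupp g), (fun m => g@_m / d`!%:R).
have fact_neq0 : d`!%:R != 0 :> rat by rewrite Num.Theory.pnatr_eq0 -lt0n fact_gt0.
apply: (mulfI (vand_xvar_neq0 (leqnn d))); rewrite -/g.
have anti_g (s : 'S_d) : (-1) ^+ s * msym s g = g.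
  by rewrite msymM sym_f msym_vand mulrA signrMK.
have sum_g : d`!%:R *: g = \sum_(s : 'S_d) (-1) ^+ s * msym s g.
  by rewrite (eq_bigr (fun=> g)) ?sumr_const ?card_Sn ?scaler_nat.
have alt_m m : \sum_(s : 'S_d) (-1) ^+ s * msym s 'X_[m] =
    alternant (fun i => m i) :> {mpoly rat[d]}.
  rewrite /alternant -det_tr; apply: eq_bigr => s _; congr (_ * _).
  rewrite mpolyXE_id rmorph_prod; apply: eq_bigr => i _.
  by rewrite rmorphXn /= !mxE /msym mmapX mmap1U.
apply: (scalerI fact_neq0); rewrite {}sum_g.
under eq_bigr => s _ do rewrite {1}[g]mpolyE raddf_sum mulr_sumr.
rewrite exchange_big mulr_sumr scaler_sumr; apply: eq_bigr => m _ /=.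
under eq_bigr => s _ do rewrite msymZ -scalerAr.
by rewrite -scaler_sumr alt_m alternantE -scalerAr scalerA mulrCA divff ?mulr1.
Qed.

(** * Linear independence of the Schur classes *)

(** The coefficient of x_1^0 x_2^1 ... x_n^(n-1) in the antisymmetrization of p *)
Definition alt_coef n (p : {mpoly rat[n]}) : rat :=
  \sum_(s : 'S_n) (-1) ^+ s * p@_[multinom (s i : nat) | i < n].

Lemma alt_coef_is_linear n : linear (@alt_coef n : _ -> rat^o).
Proof.
move=> c p q; rewrite /alt_coef scaler_sumr -big_split; apply: eq_bigr => s _ /=.
by rewrite mcoeffD mcoeffZ mulrDr [c *: _]mulrCA.
Qed.

HB.instance Definition _ n :=
  GRing.isLinear.Build rat {mpoly rat[n]} rat^o _ (@alt_coef n) (@alt_coef_is_linear n).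

Lemma alt_coefX n (m : 'X_{1..n}) :
  alt_coef 'X_[m] = \det (\matrix_(i < n, j < n) (m i == j)%:R).
Proof.
apply: eq_bigr => s _; congr (_ * _); rewrite mcoeffX.
under [RHS]eq_bigr do rewrite mxE.
case: eqP => [->|ne_m].
  by rewrite big1 // => i _; rewrite mnmE eqxx.
case: (pickP (fun i => m i != s i)) => [i /negPf ne_i|eq_m].
  by rewrite (bigD1 i) //= ne_i mul0r.
by case: ne_m; apply/mnmP => i; rewrite mnmE; apply/eqP/negbFE/eq_m.
Qed.

Lemma alt_coef_msym n (s : 'S_n) (p : {mpoly rat[n]}) :
  alt_coef (msym s p) = (-1) ^+ s * alt_coef p.
Proof.
rewrite /alt_coef mulr_sumr [RHS](reindex_inj (mulgI s)) /=; apply: eq_bigr => t _.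
rewrite mcoeff_sym mulrA odd_permM signr_addb signrMK; congr (_ * p@_ _).
by apply/mnmP => i; rewrite !mnmE permM.
Qed.

(** If two exponents of m are equal, 'X_[m] * e_k is invariant under a
    transposition; if the exponents of m are distinct and a monomial of the
    product contributes, then they are 0, ..., n-1 in some order and the degree
    of the product is too large. *)
Lemma alt_coef_mesym n (m : 'X_{1..n}) k : (0 < k)%N ->
  alt_coef ('X_[m] * mesym n rat k) = 0.
Proof.
move=> k_gt0; case: (boolP (injectiveb m)) => [/injectiveP inj_m|]; last first.
  case/injectivePn => i [j ne_ij eq_m].
  have /eqP := alt_coef_msym (tperm i j) ('X_[m] * mesym n rat k).
  rewrite odd_tperm ne_ij expr1 mulN1r msymM msymX (issymP _ (mesym_sym _ _ _)).
  rewrite (_ : [multinom _ | _ < n] = m); last first.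
    by apply/mnmP => l; rewrite mnmE tpermV; case: tpermP => [->|->|].
  by rewrite -addr_eq0 -mulr2n Num.Theory.mulrn_eq0 => /eqP.
rewrite mesymE mulr_sumr raddf_sum big1 // => h /eqP def_k /=.
rewrite /alt_coef big1 // => s _; rewrite -mpolyXD mcoeffX.
case: eqP => [/mnmP eq_s|]; last by rewrite mulr0.
have eq_si i : (m i + (i \in h) = s i)%N by have := eq_s i; rewrite mnmDE !mnmE.
have lt_m i : (m i < n)%N.
  by apply: leq_ltn_trans (ltn_ord (s i)); rewrite -eq_si leq_addr.
have inj_t : injective (fun i => Ordinal (lt_m i)).
  by move=> i j [/inj_m].
(* Both m and s enumerate 0, ..., n-1, so that the two sums are equal. *)
have : (\sum_i (m i + (i \in h)) = \sum_(i < n) m i)%N.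
  rewrite (eq_bigr (fun i => s i : nat)) => [|i _]; last exact: eq_si.
  rewrite -(reindex_inj (h := s) (P := xpredT) (F := fun i : 'I_n => i : nat)) //=.
    by rewrite (reindex_inj inj_t).
  exact: perm_inj.
rewrite big_split /= -big_mkcond sum1_card def_k => /eqP.
by rewrite -[X in _ == X]addn0 eqn_add2l => /eqP k0; rewrite k0 in k_gt0.
Qed.

Lemma alt_coef_ideal n (p : {mpoly rat[n]}) : esym_ideal p -> alt_coef p = 0.
Proof.
case/asboolP => a ->; rewrite raddf_sum big1 // => i _.
rewrite [a i]mpolyE mulr_suml raddf_sum big1 // => m _ /=.
by rewrite -scalerAl linearZ /= alt_coef_mesym // scaler0.
Qed.

(** The exponents a on the first d variables and c on the last q ones *)
Definition shuffle d q (a : 'I_d -> nat) (c : 'I_q -> nat) : 'X_{1..d + q} :=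
  [multinom match fintype.split i with inl i => a i | inr j => c j end | i < d + q].

(** The d! monomials of the alternant in the first d variables differ by
    permutations of these variables, and contribute equally. *)
Lemma alt_coef_alternant d q (a : 'I_d -> nat) (c : 'I_q -> nat) :
  alt_coef (\det (\matrix_(i < d, j < d) xvar (d + q) i ^+ a j)
         * \prod_(j < q) 'X_(rshift d j) ^+ c j) =
  d`!%:R * alt_coef 'X_[shuffle a c].
Proof.
have mon (b : 'I_d -> nat) : 'X_[shuffle b c] =
    (\prod_(i < d) xvar (d + q) i ^+ b i) * \prod_(j < q) 'X_(rshift d j) ^+ c j.
  rewrite mpolyXE_id big_split_ord /=; congr (_ * _); apply: eq_bigr => i _.
    by rewrite mnmE (unsplitK (inl i)) -[nat_of_ord i]/(nat_of_ord (lshift q i)) xvar_ord.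
  by rewrite mnmE (unsplitK (inr i)).
rewrite mulr_suml raddf_sum /= mulr_natl -card_Sn -sumr_const.
apply: eq_bigr => s _.
under eq_bigr => i _ do rewrite mxE.
rewrite -mulrA -(mon (a \o s)) -(rmorph_sign (@mpolyC (d + q) rat)) mul_mpolyC.
rewrite linearZ /= !alt_coefX -[RHS](signrMK s); congr (_ * _).
(* Permuting the first d rows is left multiplication by a block matrix. *)
pose B := block_mx (perm_mx s) 0 0 (1%:M : 'M[rat]_q).
have {1}<- : \det B = (-1) ^+ s by rewrite det_ublock det_perm det1 mulr1.
rewrite -det_mulmx; congr (\det _).
set M := \matrix_(i, j) _; set N := \matrix_(i, j) _.
rewrite -[N]vsubmxK /B mul_block_col !mul0mx addr0 add0r mul1mx -row_permE.
rewrite -[M]vsubmxK; congr col_mx; apply/matrixP => i j; rewrite !mxE !mnmE.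
  by rewrite !(unsplitK (inl _)).
by rewrite !(unsplitK (inr _)).
Qed.

Lemma exps_enum_val n (K : {set 'I_n}) (i : 'I_#|K|) : exps K i = enum_val i.
Proof.
have x0 := enum_val i; rewrite (enum_val_nth x0) /exps (nth_map x0) //.
by rewrite -cardE.
Qed.

(** An element of K outside L occurs twice among the exponents. *)
Lemma alt_coef_shuffle_eq0 d q (K L : {set 'I_(d + q)}) :
    #|K| = d -> #|~: L| = q -> ~~ (K \subset L) ->
  alt_coef 'X_[shuffle (fun i : 'I_d => exps K i) (fun j : 'I_q => exps (~: L) j)] = 0.
Proof.
move=> cK cL /subsetPn[x xK xL]; rewrite alt_coefX.
have xL' : x \in ~: L by rewrite inE.
pose i := cast_ord cK (enum_rank_in xK x).
pose j := cast_ord cL (enum_rank_in xL' x).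
apply: (@determinant_alternate _ _ _ (lshift q i) (rshift d j)).
  by rewrite eq_lrshift.
move=> l; rewrite !mxE !mnmE (unsplitK (inl _)) (unsplitK (inr _)).
rewrite [exps K _](exps_enum_val (enum_rank_in xK x)).
rewrite [exps (~: L) _](exps_enum_val (enum_rank_in xL' x)).
by rewrite !enum_rankK_in.
Qed.

Lemma alt_coef_shuffle_neq0 d q (K : {set 'I_(d + q)}) :
    #|K| = d -> #|~: K| = q ->
  alt_coef 'X_[shuffle (fun i : 'I_d => exps K i) (fun j : 'I_q => exps (~: K) j)] != 0.
Proof.
move=> cK cKc; rewrite alt_coefX.
pose f (i : 'I_(d + q)) := match fintype.split i with
  | inl i => enum_val (cast_ord (esym cK) i)
  | inr j => enum_val (cast_ord (esym cKc) j) end.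
have f_inj : injective f.
  move=> i j; rewrite /f -[i]splitK -[j]splitK !unsplitK.
  case: (fintype.split i) => i'; case: (fintype.split j) => j'.
  - by move/enum_val_inj/cast_ord_inj ->.
  - move=> eq_v; have := enum_valP (cast_ord (esym cKc) j').
    by rewrite -eq_v inE enum_valP.
  - move=> eq_v; have := enum_valP (cast_ord (esym cKc) i').
    by rewrite eq_v inE enum_valP.
  - by move/enum_val_inj/cast_ord_inj ->.
rewrite (_ : (\matrix_(i, j) _) = perm_mx (perm f_inj)).
  by rewrite det_perm signr_eq0.
apply/matrixP => i j; rewrite !mxE !mnmE permE /f.
case: (fintype.split i) => l.
  by rewrite -[nat_of_ord l]/(nat_of_ord (cast_ord (esym cK) l)) exps_enum_val.
by rewrite -[nat_of_ord l]/(nat_of_ord (cast_ord (esym cKc) l)) exps_enum_val.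
Qed.

(** To isolate the coefficient of K0, multiply by the Vandermonde product of the
    first d variables and by the monomial in the other variables whose exponents
    are the elements of the complement of K0. *)
Lemma schur_of_set_free n d (v : {set 'I_n} -> rat) :
    cls (\sum_(K : {set 'I_n} | #|K| == d) v K *: schur_of_set K d) = 0 ->
  forall K : {set 'I_n}, #|K| = d -> v K = 0.
Proof.
move=> /cls_eq0 sum_I K0 cK0.
have [q eq_n] : exists q, n = (d + q)%N.
  by exists (n - d)%N; rewrite subnKC // -cK0 -[leqRHS]card_ord max_card.
subst n.
have cK0c : #|~: K0| = q by apply/eqP; rewrite -(eqn_add2l d) -{1}cK0 cardsC card_ord.
set p := \sum_(K | _) _ in sum_I.
pose c (j : 'I_q) := exps (~: K0) j.
pose w := vand (xvar (d + q)) d * \prod_(j < q) 'X_(rshift d j) ^+ c j.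
have /alt_coef_ideal : esym_ideal (w * p) by apply: (@idealMr _ (@esym_ideal (d + q))).
rewrite mulr_sumr raddf_sum (bigD1 K0) ?cK0 //= big1 => [|K /andP[/eqP cK neK]].
  rewrite addr0 -scalerAr linearZ /= schur_of_setE // mulrAC -det_alternant.
  rewrite alt_coef_alternant => /eqP.
  rewrite !mulf_eq0 (negPf (alt_coef_shuffle_neq0 _ _)) //.
  by rewrite Num.Theory.pnatr_eq0 -leqn0 leqNgt fact_gt0 /= !orbF => /eqP.
rewrite -scalerAr linearZ /= schur_of_setE // mulrAC -det_alternant.
rewrite alt_coef_alternant alt_coef_shuffle_eq0 ?mulr0 ?scaler0 //.
by apply: contra neK => sub; rewrite eqEcard sub cK cK0 leqnn.
Qed.

(** * Lagrange interpolation and the decreasing operators on S_a *)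

Section Lagrange.
Variables (F : fieldType) (n : nat) (x : nat -> F).
Hypothesis x_inj : forall i j : 'I_n, x i = x j -> i = j.

Lemma node_prod_neq0 (j : 'I_n) : \prod_(l < n | l != j) (x j - x l) != 0.
Proof.
apply/prodf_neq0 => l ne_lj; rewrite subr_eq0; apply: contra ne_lj => /eqP eq_x.
by apply/eqP/esym/x_inj.
Qed.

(** The coefficients of t^(n-1) in Lagrange's interpolation formula *)
Lemma lagrange_lead (q : {poly F}) : (size q <= n)%N ->
  \sum_(j < n) q.[x j] / \prod_(l < n | l != j) (x j - x l) = q`_n.-1.
Proof.
move=> sz_q.
pose L (j : 'I_n) : {poly F} := \prod_(l < n | l != j) ('X - (x l)%:P).
have sz_L j : size (L j) = n.
  rewrite /L size_prod => [|l _]; last by rewrite polyXsubC_eq0.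
  rewrite (eq_bigr (fun=> (2 * 1)%N)) => [|l _]; last by rewrite size_XsubC.
  rewrite -big_distrr /= sum1_card cardC1 card_ord mul2n -addnn -addSn addnK.
  by rewrite prednK // (leq_ltn_trans _ (ltn_ord j)).
have lead_L j : (L j)`_n.-1 = 1.
  have /monicP := monic_prod_XsubC (index_enum 'I_n) (fun l => l != j) (x \o val).
  by rewrite -[X in lead_coef X]/(L j) lead_coefE sz_L.
have L_sample (i j : 'I_n) : (L i).[x j] =
    if j == i then \prod_(l < n | l != j) (x j - x l) else 0.
  rewrite /L horner_prod; under eq_bigr do rewrite hornerXsubC.
  case: eqP => [-> //|/eqP ne_ji].
  by rewrite (bigD1 j) //= subrr mul0r.
pose c (j : 'I_n) := q.[x j] / \prod_(l < n | l != j) (x j - x l).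
(* Lagrange: a polynomial of size at most n with n distinct roots is zero. *)
have : q - \sum_(j < n) c j *: L j = 0.
  apply: (@roots_geq_poly_eq0 _ _ [seq x j | j : 'I_n]).
  - apply/allP => _ /mapP[i _ ->]; rewrite /root hornerD hornerN horner_sum.
    rewrite (bigD1 i) //= big1 => [|j /negPf ne_ji].
      by rewrite addr0 hornerZ L_sample eqxx divfK ?subrr // node_prod_neq0.
    by rewrite hornerZ L_sample eq_sym ne_ji mulr0.
  - by rewrite map_inj_uniq ?enum_uniq // => i j /x_inj.
  rewrite size_map -cardE card_ord; apply: leq_trans (size_polyD _ _) _.
  rewrite geq_max sz_q size_polyN; apply: leq_trans (size_sum _ _ _) _.
  by apply/bigmax_leqP => j _; apply: leq_trans (size_scale_leq _ _) _; rewrite sz_L.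
move/eqP; rewrite subr_eq0 => /eqP {2}->; rewrite coef_sum.
by apply: eq_bigr => j _; rewrite coefZ lead_L mulr1.
Qed.

Lemma sum_pow_node_prod k : (0 < n)%N ->
  \sum_(j < n) x j ^+ k / \prod_(l < n | l != j) (x j - x l) = newton_coef x k n.-1.
Proof.
move=> n_gt0.
pose q : {poly F} := \sum_(m < n) newton_coef x k m *: \prod_(l < m) ('X - (x l)%:P).
have sz_N m : size (\prod_(l < m) ('X - (x l)%:P) : {poly F}) = m.+1.
  by rewrite size_prod_XsubC /index_enum -enumT size_enum_ord.
have q_sample (j : 'I_n) : q.[x j] = x j ^+ k.
  rewrite (@newton_expansion _ x n) ?newton_prod_eq0 // horner_sum.
  apply: eq_bigr => m _; rewrite hornerZ horner_prod; congr (_ * _).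
  by apply: eq_bigr => l _; rewrite hornerXsubC.
under eq_bigr => j _ do rewrite -q_sample.
rewrite lagrange_lead; last first.
  apply: leq_trans (size_sum _ _ _) _; apply/bigmax_leqP => m _.
  by apply: leq_trans (size_scale_leq _ _) _; rewrite sz_N.
have lt_n : (n.-1 < n)%N by rewrite prednK.
rewrite coef_sum (bigD1 (Ordinal lt_n)) //= [X in _ + X]big1 => [|m ne_m]; rewrite coefZ.
  have /monicP := monic_prod_XsubC (index_enum 'I_n.-1) xpredT (x \o val).
  by rewrite lead_coefE sz_N /= => ->; rewrite mulr1 addr0.
rewrite [X in _ * X]nth_default ?mulr0 // sz_N ltn_neqAle ne_m /=.
by rewrite -ltnS prednK.
Qed.
End Lagrange.

Section DecrGschur.
Variables (n e : nat).
Hypothesis lt_en : (e < n)%N.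
Implicit Types (a : 'I_e.+1 -> nat) (j : 'I_n).

(* The variables x_1, ..., x_(d-1), x_j substituted in f, where d = e + 1 *)
Let nodes j i : {mpoly rat[n]} := if (i < e)%N then xvar n i else 'X_j.

Lemma subst_last_gschur a j : subst_last j (gschur a) = newton_det (nodes j) a.
Proof.
rewrite [LHS]comp_mpoly_newton_det; apply: eq_newton_det => // l lt_ld.
by rewrite -[l]/(val (Ordinal lt_ld)) -tnth_nth tnth_mktuple.
Qed.

(** Expansion of the alternant in x_1, ..., x_(d-1), x_j along its last row, after
    division by the Vandermonde product of x_1, ..., x_(d-1). *)
Lemma newton_det_nodes a j :
  newton_det (nodes j) a * newton_prod (xvar n) e 'X_j =
  \sum_(s < e.+1) (-1) ^+ (e + s) * newton_det (xvar n) (a \o lift s) * 'X_j ^+ a s.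
Proof.
(* After multiplication by the Vandermonde product both sides are alternants. *)
apply: (mulfI (vand_xvar_neq0 (ltnW lt_en))).
rewrite mulrCA mulrC.
have eq_prod m t : (m <= e)%N -> newton_prod (nodes j) m t = newton_prod (xvar n) m t.
  move=> le_me; apply: eq_bigr => l _; congr (_ - _).
  by rewrite /nodes (leq_trans (ltn_ord l) le_me).
have <- : vand (nodes j) e.+1 = vand (xvar n) e * newton_prod (xvar n) e 'X_j.
  rewrite vandS eq_prod // [nodes j e]/nodes ltnn; congr (_ * _).
  by apply: eq_bigr => l _; rewrite eq_prod 1?ltnW // [nodes j l]/nodes ltn_ord.
rewrite -det_alternant (expand_det_row _ ord_max) mulr_sumr.
apply: eq_bigr => s _; rewrite mxE /nodes ltnn mulrC /cofactor mulrA.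
congr (_ * _); rewrite mulrCA -det_alternant; congr (_ * \det _).
by apply/matrixP => i l; rewrite !mxE lift_max ltn_ord.
Qed.

Lemma node_prod_split j : (e <= j)%N ->
  newton_prod (xvar n) e 'X_j * \prod_(l < n | (e <= l)%N && (l != j)) ('X_j - 'X_l) =
  \prod_(l < n | l != j) ('X_j - 'X_l).
Proof.
move=> le_ej; rewrite [RHS](bigID (fun l : 'I_n => (e <= l)%N)) /= mulrC.
congr (_ * _); first by apply: eq_bigl => l; rewrite andbC.
rewrite /newton_prod (big_ord_widen n (fun l => 'X_j - xvar n l) (ltnW lt_en)).
apply: eq_big => [l|l _]; last by rewrite xvar_ord.
rewrite -ltnNge andbC; case: ltnP => //= lt_le; apply/esym.
by apply: contraTneq lt_le => ->; rewrite -leqNgt.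
Qed.

(** The terms are rewritten with the denominators of Lagrange interpolation at
    all of x_1, ..., x_n; the terms with j < d that this adds are zero. *)
Lemma decr_frac_gschur a r :
  decr_frac n r (gschur a) = tofrac (\sum_(s < e.+1)
    (-1) ^+ (e + s) * newton_det (xvar n) (a \o lift s)
      * newton_coef (xvar n) (a s + r) n.-1).
Proof.
pose x (l : nat) : {fraction {mpoly rat[n]}} := tofrac (xvar n l).
have x_inj (i j : 'I_n) : x i = x j -> i = j.
  by move/eqP; rewrite tofrac_eq => /eqP /xvar_inj eq_ij; apply/val_inj/eq_ij.
have def_dP j : \prod_(l < n | l != j) (x j - x l) =
    tofrac (\prod_(l < n | l != j) ('X_j - 'X_l)).
  by rewrite rmorph_prod; apply: eq_bigr => l _; rewrite /x !xvar_ord rmorphB.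
pose E j := \sum_(s < e.+1)
  (-1) ^+ (e + s) * newton_det (xvar n) (a \o lift s) * 'X_j ^+ a s.
transitivity (\sum_(j < n) tofrac (E j * 'X_j ^+ r) / \prod_(l < n | l != j) (x j - x l)).
  rewrite [RHS](bigID (fun j : 'I_n => (e <= j)%N)) /= [X in _ + X]big1 ?addr0.
    apply: eq_bigr => j le_ej; rewrite def_dP -node_prod_split //.
    rewrite /E -newton_det_nodes subst_last_gschur mulrAC [newton_prod _ _ _ * _]mulrC.
    have nz : newton_prod (xvar n) e 'X_j != 0.
      apply/prodf_neq0 => l _; rewrite subr_eq0 -xvar_ord; apply/negP => /eqP eq_x.
      have /eqP := xvar_inj (ltn_ord j) (ltn_trans (ltn_ord l) lt_en) eq_x.
      by rewrite gtn_eqF // (leq_trans (ltn_ord l)).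
    by rewrite !(tofracM _ (newton_prod _ _ _)) -mulf_div divff ?mulr1 // tofrac_eq0.
  move=> j; rewrite -ltnNge => lt_je; rewrite /E -newton_det_nodes.
  by rewrite -(xvar_ord j) newton_prod_eq0 // mulr0 mul0r tofrac0 mul0r.
have n_gt0 : (0 < n)%N by apply: leq_ltn_trans lt_en.
rewrite rmorph_sum /=; under eq_bigr => j _ do rewrite /E mulr_suml rmorph_sum mulr_suml.
rewrite exchange_big; apply: eq_bigr => s _ /=.
move: (_ * newton_det _ _) => c.
rewrite [RHS]tofracM rmorph_newton_coef -(sum_pow_node_prod x_inj) // mulr_sumr.
by apply: eq_bigr => j _; rewrite -mulrA -exprD tofracM tofracXn -mulrA /x xvar_ord.
Qed.

End DecrGschur.

Lemma cls_newton_coef n k : (0 < n)%N ->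
  cls (newton_coef (xvar n) k n.-1) = (k == n.-1)%:R.
Proof.
move=> n_gt0; rewrite rmorph_newton_coef.
case: (ltngtP k n.-1) => [lt_k|gt_k|->]; last exact: newton_coef_diag.
  by rewrite newton_coef_gt.
by rewrite (newton_coef_vanish (prod_cls_xvar n)) //; lia.
Qed.

Lemma cls_newton_det_ge n d (a : 'I_d -> nat) j : (d <= n)%N -> (n <= a j)%N ->
  cls (newton_det (xvar n) a) = 0.
Proof.
move=> le_dn le_na; rewrite rmorph_newton_det.
exact: (newton_det_vanish (prod_cls_xvar n) le_dn le_na).
Qed.

(** phi_r^- S_a in R(n): only the exponents a_s = n - r - 1 contribute. *)
Lemma cls_decr_gschur n e (a : 'I_e.+1 -> nat) (r : 'I_n) : (e < n)%N ->
  cls (poly_of_frac (decr_frac n r (gschur a))) =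
  \sum_(s < e.+1 | a s == rev_ord r)
    (-1) ^+ (e + s) * cls (newton_det (xvar n) (a \o lift s)).
Proof.
move=> lt_en; rewrite decr_frac_gschur // poly_of_fracE rmorph_sum [RHS]big_mkcond.
apply: eq_bigr => s _; rewrite 2!rmorphM rmorph_sign /= cls_newton_coef.
  rewrite (_ : (_ == n.-1) = (a s == rev_ord r)).
    by case: ifP; rewrite ?mulr1 ?mulr0.
  have lt_rn := ltn_ord r; rewrite /=; apply/eqP/eqP; lia.
exact: leq_ltn_trans lt_en.
Qed.

(** * Symmetric polynomials as combinations of Schur classes *)

(** To relate every symmetric polynomial to some element of the exterior algebra by
    a linear relation P, it is enough to relate S_a to 0 when some a_j >= n, and
    S_K to the basis vector of K. *)
Lemma symmetric_ind n d (P : {mpoly rat[d]} -> extalg n -> Prop) :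
    P 0 0 ->
    (forall c f g v w, P f v -> P g w -> P (c *: f + g) (c *: v + w)) ->
    (forall (a : 'I_d -> nat) j, (n <= a j)%N -> P (gschur a) 0) ->
    (forall K : {set 'I_n}, #|K| = d ->
       P (gschur (fun i : 'I_d => exps K i)) (ext_basis K)) ->
  forall f, f \is symmetric -> exists v, P f v.
Proof.
move=> P0 Plin Pbig Pset f /symmetric_gschur_span[r [c ->]].
suff Pa (a : 'I_d -> nat) : exists v, P (gschur a) v.
  elim: r => [|m r [w Pw]]; first by exists 0; rewrite big_nil.
  have [v Pv] := Pa (fun i => m i).
  by exists (c m *: v + w); rewrite big_cons; apply: Plin.
case: (pickP (fun j => n <= a j)%N) => [j /Pbig Pa0|/= small]; first by exists 0.
have lt_an i : (a i < n)%N by rewrite ltnNge small.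
case: (boolP (injectiveb a)) => [/injectiveP inj_a|]; last first.
  case/injectivePn => i [j ne_ij eq_a]; exists 0.
  by rewrite /gschur (newton_det_dup _ ne_ij eq_a).
(* For injective a with values below n, a = exps K o s with K the image of a. *)
pose b i := Ordinal (lt_an i).
have inj_b : injective b by move=> i j [/inj_a].
pose K := [set b i | i in 'I_d]; have cK : #|K| = d by rewrite card_imset // card_ord.
have bK i : b i \in K by apply: imset_f.
pose t i := cast_ord cK (enum_rank_in (bK i) (b i)).
have t_exps i : exps K (t i) = a i.
  by rewrite [LHS](exps_enum_val (enum_rank_in (bK i) (b i))) enum_rankK_in.
have inj_t : injective t.
  by move=> i j /(congr1 (fun l : 'I_d => exps K l)); rewrite !t_exps => /inj_a.
pose s : 'S_d := perm inj_t.
exists ((-1) ^+ s *: ext_basis K + 0).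
rewrite (_ : gschur a = (-1) ^+ s *: gschur (fun i : 'I_d => exps K i) + 0).
  exact/Plin/P0/Pset.
rewrite addr0 -mul_mpolyC rmorph_sign -newton_det_perm.
by apply: eq_newton_det => // i; rewrite /= permE t_exps.
Qed.

Lemma exps_setD1 n (K : {set 'I_n}) (i : 'I_n) l : i \in K ->
  exps (K :\ i) l = exps K (bump (index i (enum K)) l).
Proof.
move=> iK; have iK' : i \in enum K by rewrite mem_enum.
have -> : exps (K :\ i) l = nth 0%N (map val (rem i (enum K))) l.
  rewrite /exps rem_filter ?enum_uniq //; congr (nth _ (map _ _) l).
  rewrite /enum_mem -filter_predI; apply: eq_filter => j.
  by rewrite /= !inE.
rewrite /exps; move: (enum K) iK' => t; elim: t l => //= j t IHt [|l]; rewrite inE;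
  case: (eqVneq j i) => [->|ne_ji] //=; rewrite ?eqxx //.
by rewrite bumpS => /IHt ->.
Qed.

(** * The map Theta and the right partial derivatives *)

Lemma ThetaE n (v : extalg n) (d : 'I_n.+1) :
  Theta v d = \sum_(K : {set 'I_n} | #|K| == d) cls (v K)%:MP * cls (schur_of_set K d).
Proof.
rewrite ffunE rmorph_sum; apply: eq_bigr => K _.
by rewrite -rmorphM mul_mpolyC.
Qed.

Lemma Theta_linear n c (v w : extalg n) (d : 'I_n.+1) :
  Theta (c *: v + w) d = cls c%:MP * Theta v d + Theta w d.
Proof.
rewrite !ThetaE mulr_sumr -big_split; apply: eq_bigr => K _ /=.
by rewrite !ffunE mpolyCD mpolyCM rmorphD rmorphM mulrDl mulrA.
Qed.

Lemma Theta0 n (d : 'I_n.+1) : Theta 0 d = 0.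
Proof. by rewrite ThetaE big1 // => K _; rewrite ffunE mpolyC0 raddf0 mul0r. Qed.

Lemma Theta_basis n (K : {set 'I_n}) (d : 'I_n.+1) : #|K| = d ->
  Theta (ext_basis K) d = cls (schur_of_set K d).
Proof.
move=> cK; rewrite ThetaE (bigD1 K) ?cK //= ffunE eqxx rmorph1 mul1r big1 ?addr0 //.
by move=> L /andP[_ /negPf neL]; rewrite ffunE neL mpolyC0 raddf0 mul0r.
Qed.

Lemma eq_Theta n (v w : extalg n) (d : 'I_n.+1) :
  (forall K : {set 'I_n}, #|K| = d -> v K = w K) -> Theta v d = Theta w d.
Proof. by move=> eq_vw; rewrite !ThetaE; apply: eq_bigr => K /eqP /eq_vw ->. Qed.

Lemma Theta_inj n (v w : extalg n) (d : 'I_n.+1) : Theta v d = Theta w d ->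
  forall K : {set 'I_n}, #|K| = d -> v K = w K.
Proof.
move=> eq_T K cK; apply/eqP; rewrite -subr_eq0; apply/eqP.
have : Theta (-1 *: w + v) d = 0.
  by rewrite Theta_linear eq_T mpolyCN raddfN /= rmorph1 mulN1r addNr.
rewrite ffunE => /schur_of_set_free /(_ K cK).
by rewrite !ffunE /= scaleN1r addrC.
Qed.

Lemma partialRE n (i : 'I_n) (v : extalg n) L :
  partialR i v L = \sum_(K : {set 'I_n}) v K * partialR_basis i K L.
Proof. by rewrite /partialR sum_ffunE; apply: eq_bigr => K _; rewrite ffunE. Qed.

Lemma partialR_linear n (i : 'I_n) c (v w : extalg n) :
  partialR i (c *: v + w) = c *: partialR i v + partialR i w.
Proof.
rewrite /partialR scaler_sumr -big_split; apply: eq_bigr => K _ /=.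
by rewrite !ffunE scalerDl scalerA.
Qed.

Lemma partialR0 n (i : 'I_n) : partialR i 0 = 0.
Proof. by rewrite /partialR big1 // => K _; rewrite ffunE scale0r. Qed.

Lemma partialR_ext_basis n (i : 'I_n) K :
  partialR i (ext_basis K) = partialR_basis i K.
Proof.
rewrite /partialR (bigD1 K) //= ffunE eqxx scale1r big1 ?addr0 // => L /negPf neL.
by rewrite ffunE neL scale0r.
Qed.

Lemma eq_partialR n (i : 'I_n) e (v w : extalg n) :
    (forall K : {set 'I_n}, #|K| = e.+1 -> v K = w K) ->
  forall L : {set 'I_n}, #|L| = e -> partialR i v L = partialR i w L.
Proof.
move=> eq_vw L cL; rewrite !partialRE; apply: eq_bigr => K _.
rewrite /partialR_basis; case: ifP => iK; last by rewrite ffunE !mulr0.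
rewrite !ffunE; case: eqP => [eL|]; last by rewrite !scaler0 !mulr0.
by rewrite eq_vw // (cardsD1 i) iK -eL cL.
Qed.

Lemma cls_scale n c (p : {mpoly rat[n]}) : cls (c *: p) = cls c%:MP * cls p.
Proof. by rewrite -mul_mpolyC rmorphM. Qed.

(** * The decreasing operators as partial derivatives *)

Lemma sym_Theta n (d : 'I_n.+1) (f : {mpoly rat[d]}) : f \is symmetric ->
  exists v : extalg n, cls (widen_poly n f) = Theta v d.
Proof.
have le_dn : (d <= n)%N by rewrite -ltnS.
move: f; apply: (symmetric_ind (P := fun f v => cls (widen_poly n f) = Theta v d))
  => [|c g h v w eq_v eq_w|a j le_na|K cK].
- by rewrite Theta0 /widen_poly !raddf0.
- by rewrite Theta_linear -eq_v -eq_w /widen_poly linearP /= rmorphD /= cls_scale.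
- by rewrite Theta0 widen_gschur (cls_newton_det_ge le_dn le_na).
by rewrite Theta_basis // schur_of_setE // widen_gschur.
Qed.

Lemma decr_frac_linear n d r c (f g : {mpoly rat[d]}) :
  decr_frac n r (c *: f + g) = tofrac c%:MP * decr_frac n r f + decr_frac n r g.
Proof.
rewrite /decr_frac mulr_sumr -big_split; apply: eq_bigr => j _ /=.
rewrite /subst_last linearP /= mulrDl tofracD mulrDl -mul_mpolyC -mulrA.
by rewrite tofracM !mulrA.
Qed.

Lemma sign_index n (K : {set 'I_n}) e i : #|K| = e.+1 -> i \in K ->
  (-1) ^+ (#|K| - (index i (enum K)).+1) = (-1) ^+ (e + index i (enum K)) :> rat.
Proof.
move=> cK iK; have lt_i : (index i (enum K) < e.+1)%N.
  by rewrite -cK cardE index_mem mem_enum.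
rewrite cK -signr_odd -[RHS]signr_odd; congr (_ ^+ nat_of_bool _); rewrite subSS.
by rewrite oddB // oddD.
Qed.

Lemma cls_decr_set n e (K : {set 'I_n}) (r : 'I_n) (d : 'I_n.+1) :
    #|K| = e.+1 -> d = e :> nat ->
  cls (poly_of_frac (decr_frac n r (gschur (fun i : 'I_e.+1 => exps K i)))) =
  Theta (partialR_basis (rev_ord r) K) d.
Proof.
move=> cK def_d; set i := rev_ord r.
have lt_en : (e < n)%N by rewrite -cK -[leqRHS]card_ord max_card.
rewrite cls_decr_gschur // -/i /partialR_basis.
have exps_eq (s : 'I_e.+1) : (exps K s == i) =
    (i \in K) && (s == index i (enum K) :> nat).
  have lt_s : (s < size (enum K))%N by rewrite -cardE cK.
  rewrite /exps (nth_map i) //; apply/eqP/andP => [/val_inj <-|[iK /eqP ->]].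
    by rewrite -mem_enum mem_nth // index_uniq ?enum_uniq.
  by rewrite nth_index ?mem_enum.
under eq_bigl do rewrite exps_eq.
case: ifP => iK /=; last by rewrite big_pred0 // Theta0.
have lt_i : (index i (enum K) < e.+1)%N.
  by rewrite -cK cardE index_mem mem_enum.
rewrite (big_pred1 (Ordinal lt_i)) // (sign_index cK iK).
have cKi : #|K :\ i| = d by apply/eqP; rewrite -eqSS def_d -cK (cardsD1 i K) iK.
rewrite -[_ *: _]addr0 Theta_linear Theta0 addr0 Theta_basis //.
rewrite schur_of_setE // rmorph_sign [X in _ = X * _]rmorph_sign; congr (_ * cls _).
rewrite {}def_d; apply: eq_newton_det => // l.
by rewrite /= exps_setD1.
Qed.

(** A single element v describes both the class of f and the class obtained from f by
    the explicit formula for phi_r^-. *)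
Lemma sym_decr n (d d' : 'I_n.+1) e (r : 'I_n) (f : {mpoly rat[d]}) :
    d = e.+1 :> nat -> d' = e :> nat -> f \is symmetric ->
  exists2 v : extalg n, cls (widen_poly n f) = Theta v d &
    cls (poly_of_frac (decr_frac n r f)) = Theta (partialR (rev_ord r) v) d'.
Proof.
case: d f => _d lt_d /= f def_d def_d'; subst _d => sym_f.
set d := Ordinal lt_d; set i := rev_ord r.
have lt_en : (e < n)%N by [].
pose P (g : {mpoly rat[e.+1]}) (v : extalg n) :=
  cls (widen_poly n g) = Theta v d /\
  exists2 p, decr_frac n r g = tofrac p & cls p = Theta (partialR i v) d'.
have [v [eq_v [p eq_p cls_p]]] : exists v, P f v; last first.
  by exists v => //; rewrite eq_p poly_of_fracE.
have decr_poly (a : 'I_e.+1 -> nat) :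
    exists p, decr_frac n r (gschur a) = tofrac p.
  by rewrite decr_frac_gschur //; eexists.
move: f sym_f; apply: symmetric_ind
  => [|c g h v w [eq_v [p defp eq_p]] [eq_w [q defq eq_q]]|a j le_na|K cK].
- split; first by rewrite Theta0 /widen_poly !raddf0.
  exists 0; last by rewrite partialR0 Theta0 raddf0.
  by rewrite /decr_frac big1 // => j _; rewrite /subst_last raddf0 mul0r tofrac0 mul0r.
- split.
    by rewrite Theta_linear -eq_v -eq_w /widen_poly linearP /= rmorphD /= cls_scale.
  exists (c *: p + q).
    by rewrite decr_frac_linear defp defq -tofracM -tofracD mul_mpolyC.
  by rewrite partialR_linear Theta_linear rmorphD /= cls_scale eq_p eq_q.
- split; first by rewrite Theta0 widen_gschur (cls_newton_det_ge _ le_na).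
  have [p defp] := decr_poly a; exists p => //.
  rewrite -[p]poly_of_fracE -defp cls_decr_gschur // partialR0 Theta0.
  apply: big1 => s /eqP eq_s.
  (* The exponent a_s < n is not the large one, which survives its removal. *)
  have ne_sj : s != j.
    by apply: contraTneq le_na => <-; rewrite eq_s -ltnNge ltn_ord.
  case: (unliftP s j) ne_sj => [l eq_j _|->]; last by rewrite eqxx.
  rewrite (@cls_newton_det_ge _ _ _ l (ltnW lt_en)) ?mulr0 //=.
  by rewrite -eq_j.
split; first by rewrite Theta_basis // schur_of_setE // widen_gschur.
have [p defp] := decr_poly (fun i => exps K i); exists p => //.
by rewrite -[p]poly_of_fracE -defp partialR_ext_basis (cls_decr_set _ cK def_d').
Qed.

Lemma Theta_HGr n (v : extalg n) : HGr_sum (Theta v).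
Proof.
move=> d; exists (\sum_(K : {set 'I_n} | #|K| == d)
  v K *: gschur (fun i : 'I_d => exps K i)).
  by apply: rpred_sum => K _; apply/rpredZ/gschur_sym.
rewrite ffunE; congr cls; rewrite /widen_poly raddf_sum; apply: eq_bigr => K /eqP cK.
by rewrite /= linearZ schur_of_setE //= -widen_gschur.
Qed.

(** The polynomial f chosen in [decr_comp] need not be the given combination of
    Schur polynomials, but by linear independence it has the same coordinates. *)
Lemma decr_Theta n (r : 'I_n) (v : extalg n) :
  decr r (Theta v) = Theta (partialR (rev_ord r) v).
Proof.
apply/ffunP => e; rewrite ffunE.
case: (ltnP e n) => [lt_en|le_ne]; last first.
  (* There is nothing in degree n + 1, and no set with n + 1 elements. *)
  rewrite big_pred0 => [|d]; last by rewrite ltn_eqF // ltnS (leq_trans _ le_ne) // -ltnS.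
  rewrite -(Theta0 e) -(partialR0 (rev_ord r)); apply/eq_Theta/eq_partialR => K cK.
  by have := max_card (mem K); rewrite cK card_ord ltnNge le_ne.
have lt_e : (e.+1 < n.+1)%N by [].
rewrite (big_pred1 (Ordinal lt_e)) //; set d := Ordinal lt_e.
rewrite /decr_comp; set f := xget _ _.
have [sym_f eq_f] : f \is symmetric /\ cls (widen_poly n f) = Theta v d.
  rewrite /f; case: xgetP => [g _ []//|no_f].
  by have [g sym_g eq_g] := Theta_HGr v d; case: (no_f g).
have [w eq_w ->] := @sym_decr n d e e r f erefl erefl sym_f.
apply/eq_Theta/eq_partialR/(Theta_inj (d := d)).
by rewrite -eq_w.
Qed.

Theorem proposition3p6 (n : nat) (hn : (0 < n)%N) :
  set_bij [set: extalg n] (@HGr_sum n) (@Theta n)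
  /\ (forall (r : 'I_n) (v : extalg n),
        decr r (Theta v) = Theta (partialR (rev_ord r) v))
  /\ (forall (r : 'I_n) (d : nat) (k : d.-tuple 'I_n),
        sorted (fun i j : 'I_n => i < j)%N k ->
        decr r (Theta (Phi k)) = Theta (partialR (rev_ord r) (Phi k))).
Proof.
split; last by split => [r v|r d k _]; apply: decr_Theta.
split=> [v _|v w _ _ eq_T|g Hg]; first exact: Theta_HGr.
  apply/ffunP => K.
  have lt_K : (#|K| < n.+1)%N by rewrite ltnS -[leqRHS]card_ord max_card.
  by apply: (@Theta_inj n v w (Ordinal lt_K)) => //; rewrite eq_T.
have /choice[V defV] : forall d, exists v : extalg n, g d = Theta v d.
  by move=> d; have [f /sym_Theta[v eq_v] ->] := Hg d; exists v.
exists [ffun K : {set 'I_n} => V (inord #|K|) K] => //.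
apply/ffunP => d; rewrite defV; apply: eq_Theta => K cK.
by rewrite ffunE cK inord_val.
Qed.
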